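(* Let $T_1\subseteq T_2\subseteq\cdots$ be well ordered sets, each $T_n$ carrying the restriction of the order of $T_{n+1}$, all having the same minimum and the same maximum. Let $T=\bigcup_n T_n$ with the induced linear order and let $\bar T$ be its completion. Then $\bar T$, with its order topology, is a Radon-Nikodým compact space.
   Context: The completion of a linearly ordered set $T$ is the unique linearly ordered set $\bar T\supseteq T$ (extending the order of $T$) such that $\bar T$ is compact in its order topology and $]x,y]\cap T\neq\emptyset$ for all $x<y$ in $\bar T$, where $]x,y]=\{z:x<z\le y\}$. A map $d:K\times K\to[0,+\infty)$ fragments a topological space $K$ if for every nonempty closed $L\subseteq K$ and every $\varepsilon>0$ there is a nonempty relatively open $U\subseteq L$ with $\sup\{d(x,y):x,y\in U\}<\varepsilon$; $d$ is lower semicontinuous if $\{(x,y):d(x,y)\le a\}$ is closed for all $a\ge0$. A compact space $K$ is Radon-Nikodým compact if there is a lower semicontinuous metric on $K$ which fragments $K$. *)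

(* Defs.v *)
From Stdlib Require Import Reals List.
Open Scope R_scope.

Record StrictLinOrder (X : Type) (lt : X -> X -> Prop) : Prop := {
  slo_irrefl : forall x, ~ lt x x;
  slo_trans  : forall x y z, lt x y -> lt y z -> lt x z;
  slo_total  : forall x y, lt x y \/ x = y \/ lt y x
}.

Definition le_of {X : Type} (lt : X -> X -> Prop) (x y : X) : Prop :=
  lt x y \/ x = y.

Definition well_ordered_set {X : Type} (lt : X -> X -> Prop) (S : X -> Prop) : Prop :=
  forall P : X -> Prop,
    (forall x, P x -> S x) -> (exists x, P x) ->
    exists m, P m /\ forall x, P x -> le_of lt m x.

Definition is_min_of {X : Type} (lt : X -> X -> Prop) (S : X -> Prop) (m : X) : Prop :=
  S m /\ forall x, S x -> le_of lt m x.

Definition is_max_of {X : Type} (lt : X -> X -> Prop) (S : X -> Prop) (m : X) : Prop :=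
  S m /\ forall x, S x -> le_of lt x m.

Definition in_interval {B : Type} (lt : B -> B -> Prop)
  (lo hi : option B) (y : B) : Prop :=
  match lo with Some a => lt a y | None => True end /\
  match hi with Some b => lt y b | None => True end.

Definition order_open {B : Type} (lt : B -> B -> Prop) (U : B -> Prop) : Prop :=
  forall x, U x -> exists lo hi : option B,
    in_interval lt lo hi x /\ forall y, in_interval lt lo hi y -> U y.

Definition order_closed {B : Type} (lt : B -> B -> Prop) (F : B -> Prop) : Prop :=
  order_open lt (fun x => ~ F x).

Definition order_compact {B : Type} (lt : B -> B -> Prop) : Prop :=
  forall (I : Type) (V : I -> B -> Prop),
    (forall i, order_open lt (V i)) ->
    (forall x, exists i, V i x) ->
    exists l : list I, forall x, exists i, In i l /\ V i x.

Definition prod_closed {B : Type} (lt : B -> B -> Prop) (F : B -> B -> Prop) : Prop :=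
  forall x y, ~ F x y -> exists U V : B -> Prop,
    order_open lt U /\ order_open lt V /\ U x /\ V y /\
    forall u v, U u -> V v -> ~ F u v.

Definition is_metric {B : Type} (d : B -> B -> R) : Prop :=
  (forall x y, 0 <= d x y) /\
  (forall x y, d x y = 0 <-> x = y) /\
  (forall x y, d x y = d y x) /\
  (forall x y z, d x z <= d x y + d y z).

Definition lower_semicontinuous {B : Type} (lt : B -> B -> Prop) (d : B -> B -> R) : Prop :=
  forall a, 0 <= a -> prod_closed lt (fun x y => d x y <= a).

(* d fragments K: for each nonempty closed L and eps > 0 there is a nonempty
   relatively open U of L with sup {d x y | x, y in U} < eps (i.e. the
   d-diameters in U are bounded by some c < eps). *)
Definition fragments {B : Type} (lt : B -> B -> Prop) (d : B -> B -> R) : Prop :=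
  forall (L : B -> Prop) (eps : R),
    order_closed lt L -> (exists x, L x) -> 0 < eps ->
    exists O : B -> Prop,
      order_open lt O /\ (exists x, L x /\ O x) /\
      exists c, c < eps /\
        forall x y, L x -> O x -> L y -> O y -> d x y <= c.

Definition RN_compact {B : Type} (lt : B -> B -> Prop) : Prop :=
  order_compact lt /\
  exists d : B -> B -> R, is_metric d /\ lower_semicontinuous lt d /\ fragments lt d.

Definition is_completion {A B : Type} (ltA : A -> A -> Prop) (T : A -> Prop)
  (ltB : B -> B -> Prop) (e : A -> B) : Prop :=
  StrictLinOrder B ltB /\
  (forall a b, T a -> T b -> (ltA a b <-> ltB (e a) (e b))) /\
  order_compact ltB /\
  (forall x y, ltB x y -> exists t, T t /\ ltB x (e t) /\ le_of ltB (e t) y).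

(* Main.v *)
Require Import Defs.
From Stdlib Require Import Reals List.
From Stdlib Require Import Lra Lia Classical ClassicalEpsilon.

(** The metric is [d x y = sup 2^-n |f x - f y|], over [n] and over a family [F n]
    of continuous functions into [[0,1]]; such a supremum is lower semicontinuous.
    [F n] consists of the indicators of [[t, oo)] for [t] in [T_n] with an immediate
    predecessor, and of one Urysohn function for each pair [s < t] of consecutive
    elements of [T_n]. All but one member of [F n] are constant on a set of points
    lying below the same elements of [T_n], and in any nonempty [L] the points [x]
    whose first element of [T_n] above [x] is least form such a set, relatively open
    in [L]. Continuity of the remaining function then makes [F n] oscillate
    little near a point of [L], and finitely many [n] suffice for a given [eps]. *)

(** * Order continuity and powers of one half *)

Definition order_continuous {B : Type} (lt : B -> B -> Prop) (f : B -> R) : Prop :=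
  forall x eps, 0 < eps -> exists lo hi,
    in_interval lt lo hi x /\
    forall y, in_interval lt lo hi y -> Rabs (f y - f x) <= eps.

Definition unit_valued {B : Type} (f : B -> R) : Prop := forall x, 0 <= f x <= 1.

Lemma pow_half_pos (n : nat) : 0 < (1 / 2) ^ n.
Proof. apply pow_lt; lra. Qed.

Lemma pow_half_le (n k : nat) : (n <= k)%nat -> (1 / 2) ^ k <= (1 / 2) ^ n.
Proof.
  induction 1 as [|k _ IH]; simpl; [lra|].
  pose proof (pow_half_pos k); lra.
Qed.

Lemma pow_half_small (eps : R) : 0 < eps -> exists n, (1 / 2) ^ n <= eps.
Proof.
  intros He.
  assert (Hh : Rabs (1 / 2) < 1) by (rewrite Rabs_pos_eq; lra).
  destruct (pow_lt_1_zero _ Hh eps He) as [n Hn].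
  exists n. specialize (Hn n (le_n n)).
  pose proof (Rle_abs ((1 / 2) ^ n)); lra.
Qed.

(** * Linear orders and their open intervals *)

Section LinearOrder.

Variables (B : Type) (lt : B -> B -> Prop).
Hypothesis HB : StrictLinOrder B lt.

Let irr := slo_irrefl B lt HB.
Let tr := slo_trans B lt HB.
Let tot := slo_total B lt HB.

Lemma not_lt_le (x y : B) : ~ lt x y -> le_of lt y x.
Proof. unfold le_of; destruct (tot x y) as [H|[H|H]]; subst; tauto. Qed.

Lemma le_not_lt (x y : B) : le_of lt y x -> ~ lt x y.
Proof. intros [H|<-] H'; [apply (irr x); eauto | eapply irr; eauto]. Qed.

Lemma le_lt_trans (x y z : B) : le_of lt x y -> lt y z -> lt x z.
Proof. intros [H|<-]; eauto. Qed.

Lemma lt_le_trans (x y z : B) : lt x y -> le_of lt y z -> lt x z.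
Proof. intros H [H'|<-]; eauto. Qed.

(** The larger lower endpoint and the smaller upper endpoint work, with [None] read as infinity. *)
Lemma in_interval_inter (l1 h1 l2 h2 : option B) (x : B) :
  in_interval lt l1 h1 x -> in_interval lt l2 h2 x ->
  exists l h, in_interval lt l h x /\ forall y, in_interval lt l h y ->
    in_interval lt l1 h1 y /\ in_interval lt l2 h2 y.
Proof.
  intros [Hl1 Hh1] [Hl2 Hh2].
  assert (El : exists l, match l with Some a => lt a x | None => True end /\
    forall y, match l with Some a => lt a y | None => True end ->
      match l1 with Some a => lt a y | None => True end /\
      match l2 with Some a => lt a y | None => True end).
  { destruct l1 as [a|]; [|exists l2; tauto].
    destruct l2 as [b|]; [|exists (Some a); tauto].
    destruct (tot a b) as [H|[<-|H]]; [exists (Some b)|exists (Some a)|exists (Some a)];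
      (split; [assumption|intros y Hy; split; eauto]). }
  assert (Eh : exists h, match h with Some a => lt x a | None => True end /\
    forall y, match h with Some a => lt y a | None => True end ->
      match h1 with Some a => lt y a | None => True end /\
      match h2 with Some a => lt y a | None => True end).
  { destruct h1 as [a|]; [|exists h2; tauto].
    destruct h2 as [b|]; [|exists (Some a); tauto].
    destruct (tot a b) as [H|[<-|H]]; [exists (Some a)|exists (Some a)|exists (Some b)];
      (split; [assumption|intros y Hy; split; eauto]). }
  destruct El as [l [Hl Il]], Eh as [h [Hh Ih]].
  exists l, h; split; [split; assumption|].
  intros y [Hy1 Hy2]; specialize (Il y Hy1); specialize (Ih y Hy2).
  unfold in_interval; tauto.
Qed.

Lemma order_open_interval (lo hi : option B) : order_open lt (in_interval lt lo hi).
Proof. intros x Hx; exists lo, hi; auto. Qed.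

Lemma order_open_inter (U V : B -> Prop) :
  order_open lt U -> order_open lt V -> order_open lt (fun x => U x /\ V x).
Proof.
  intros HU HV x [Ux Vx].
  destruct (HU x Ux) as (l1 & h1 & I1 & S1), (HV x Vx) as (l2 & h2 & I2 & S2).
  destruct (in_interval_inter _ _ _ _ _ I1 I2) as (l & h & I & S).
  exists l, h; split; [exact I|].
  intros y Hy; destruct (S y Hy); auto.
Qed.

(** * Metrics from families of functions *)

Section FamilyMetric.

Variable F : nat -> (B -> R) -> Prop.
Hypothesis F_unit : forall n f, F n f -> unit_valued f.
Hypothesis F_cont : forall n f, F n f -> order_continuous lt f.
Hypothesis F_sep : forall x y, lt x y -> exists n f, F n f /\ f x <> f y.
(** [L] ranges over all nonempty sets, so that the condition can be applied again to the
    intersection of [L] with an open set. *)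
Hypothesis F_frag : forall n (L : B -> Prop) eps, (exists x, L x) -> 0 < eps ->
  exists O, order_open lt O /\ (exists x, L x /\ O x) /\
    forall f x y, F n f -> L x -> O x -> L y -> O y -> Rabs (f x - f y) <= eps.

(* The disjunct [r = 0] keeps the set nonempty when [F] is. *)
Definition family_gap (x y : B) (r : R) : Prop :=
  r = 0 \/ exists n f, F n f /\ r = (1 / 2) ^ n * Rabs (f x - f y).

Lemma unit_diff_le (f : B -> R) (x y : B) : unit_valued f -> Rabs (f x - f y) <= 1.
Proof.
  intros Hf; pose proof (Hf x); pose proof (Hf y); apply Rabs_le; lra.
Qed.

Lemma family_gap_bound (x y : B) : bound (family_gap x y).
Proof.
  exists 1; intros r [->|(n & f & Hf & ->)]; [lra|].
  pose proof (unit_diff_le f x y (F_unit _ _ Hf)).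
  pose proof (pow_half_pos n); pose proof (pow_half_le 0 n (Nat.le_0_l n)).
  pose proof (Rabs_pos (f x - f y)); simpl in *; nra.
Qed.

Lemma family_gap_inhabited (x y : B) : exists r, family_gap x y r.
Proof. exists 0; left; reflexivity. Qed.

Definition family_dist (x y : B) : R :=
  proj1_sig (completeness _ (family_gap_bound x y) (family_gap_inhabited x y)).

Lemma family_dist_ge (n : nat) (f : B -> R) (x y : B) :
  F n f -> (1 / 2) ^ n * Rabs (f x - f y) <= family_dist x y.
Proof.
  intros Hf; unfold family_dist; destruct completeness as [m Hm]; simpl; destruct Hm as [Hm _].
  apply Hm; right; eauto.
Qed.

Lemma family_dist_nonneg (x y : B) : 0 <= family_dist x y.
Proof.
  unfold family_dist; destruct completeness as [m Hm]; simpl; destruct Hm as [Hm _].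
  apply Hm; left; reflexivity.
Qed.

Lemma family_dist_le (x y : B) (c : R) : 0 <= c ->
  (forall n f, F n f -> (1 / 2) ^ n * Rabs (f x - f y) <= c) -> family_dist x y <= c.
Proof.
  intros Hc H; unfold family_dist; destruct completeness as [m Hm]; simpl; destruct Hm as [_ Hm].
  apply Hm; intros r [->|(n & f & Hf & ->)]; auto.
Qed.

Lemma family_dist_pos (x y : B) : lt x y -> 0 < family_dist x y.
Proof.
  intros Hxy; destruct (F_sep x y Hxy) as (n & f & Hf & Hne).
  apply Rlt_le_trans with (2 := family_dist_ge n f x y Hf).
  apply Rmult_lt_0_compat; [apply pow_half_pos|apply Rabs_pos_lt; lra].
Qed.

Lemma family_dist_sym_le (x y : B) : family_dist x y <= family_dist y x.
Proof.
  apply family_dist_le; [apply family_dist_nonneg|].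
  intros n f Hf; rewrite Rabs_minus_sym; apply family_dist_ge; exact Hf.
Qed.

Lemma family_dist_sym (x y : B) : family_dist x y = family_dist y x.
Proof. apply Rle_antisym; apply family_dist_sym_le. Qed.

Lemma family_dist_metric : is_metric family_dist.
Proof.
  split; [exact family_dist_nonneg|]. split; [|split; [exact family_dist_sym|]].
  - intros x y; split.
    + intros H; destruct (tot x y) as [Hl|[He|Hl]]; [|exact He|].
      * pose proof (family_dist_pos x y Hl); lra.
      * pose proof (family_dist_pos y x Hl); rewrite family_dist_sym in H; lra.
    + intros <-; apply Rle_antisym; [|apply family_dist_nonneg].
      apply family_dist_le; [lra|].
      intros n f _; rewrite Rminus_diag, Rabs_R0; lra.
  - intros x y z; apply family_dist_le.
    + pose proof (family_dist_nonneg x y); pose proof (family_dist_nonneg y z); lra.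
    + intros n f Hf.
      pose proof (family_dist_ge n f x y Hf); pose proof (family_dist_ge n f y z Hf).
      pose proof (Rabs_triang (f x - f y) (f y - f z)) as Ht.
      replace (f x - f y + (f y - f z)) with (f x - f z) in Ht by ring.
      pose proof (pow_half_pos n); nra.
Qed.

(** If the supremum exceeds [a], a single member of the family already does so, and by continuity it
    still does near [x] and near [y]. *)
Lemma family_dist_lsc : lower_semicontinuous lt family_dist.
Proof.
  intros a Ha x y Hxy.
  assert (E : exists n f, F n f /\ a < (1 / 2) ^ n * Rabs (f x - f y)).
  { apply NNPP; intros Hn; apply Hxy, family_dist_le; [exact Ha|].
    intros n f Hf; apply Rnot_lt_le; intros Hlt; apply Hn; eauto. }
  destruct E as (n & f & Hf & Hlt).
  set (g := (1 / 2) ^ n * Rabs (f x - f y) - a).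
  (* Moving both points costs at most [g / 4] each, so [Rabs (f x - f y)] drops by at most [g / 2].
     The weight is at most [1], hence the weighted difference stays above [a]. *)
  assert (Hg : 0 < g / 4) by (unfold g; lra).
  destruct (F_cont n f Hf x _ Hg) as (l1 & h1 & I1 & C1).
  destruct (F_cont n f Hf y _ Hg) as (l2 & h2 & I2 & C2).
  exists (in_interval lt l1 h1), (in_interval lt l2 h2).
  do 2 (split; [apply order_open_interval|]). do 2 (split; [assumption|]).
  intros u v Hu Hv Hle.
  pose proof (family_dist_ge n f u v Hf) as Hge.
  specialize (C1 u Hu); specialize (C2 v Hv).
  pose proof (pow_half_pos n) as Hp; pose proof (pow_half_le 0 n (Nat.le_0_l n)) as Hp1.
  simpl in Hp1.
  assert (Ht : Rabs (f x - f y) <= Rabs (f u - f v) + g / 2).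
  { replace (f x - f y) with ((f u - f v) + (- (f u - f x) + (f v - f y))) by ring.
    pose proof (Rabs_triang (f u - f v) (- (f u - f x) + (f v - f y))).
    pose proof (Rabs_triang (- (f u - f x)) (f v - f y)) as H2.
    rewrite Rabs_Ropp in H2; lra. }
  assert ((1 / 2) ^ n * Rabs (f x - f y) <= a + g / 2) by nra.
  unfold g in *; lra.
Qed.

(** Levels are treated one after another: the open set for level [N] is sought inside the part of
    [L] cut out by the earlier levels, so the bounds already obtained persist. *)
Lemma family_fragments_below (N : nat) (L : B -> Prop) (eps : R) :
  (exists x, L x) -> 0 < eps ->
  exists O, order_open lt O /\ (exists x, L x /\ O x) /\
    forall n f x y, (n < N)%nat -> F n f ->
      L x -> O x -> L y -> O y -> Rabs (f x - f y) <= eps.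
Proof.
  intros HL He; induction N as [|N IH].
  - exists (fun _ => True); split; [|split].
    + intros x _; exists None, None; repeat split.
    + destruct HL as [x Hx]; eauto.
    + intros; lia.
  - destruct IH as (O & HO & HLO & H).
    destruct (F_frag N (fun x => L x /\ O x) eps HLO He) as (O' & HO' & (x & [Lx Ox] & O'x) & H').
    exists (fun x => O x /\ O' x); split; [apply order_open_inter; assumption|].
    split; [exists x; auto|].
    intros n f u v Hn Hf Lu [Ou O'u] Lv [Ov O'v].
    destruct (Nat.eq_dec n N) as [->|Hne]; [apply H'; auto|].
    apply (H n f u v); auto; lia.
Qed.

(** Levels from [N] on contribute at most [(1 / 2) ^ N], because their members take values in the
    unit interval; the finitely many others are controlled by [family_fragments_below]. *)
Lemma family_dist_fragments : fragments lt family_dist.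
Proof.
  intros L eps _ HL He.
  destruct (pow_half_small (eps / 2) ltac:(lra)) as [N HN].
  destruct (family_fragments_below N L (eps / 2) HL ltac:(lra)) as (O & HO & HLO & H).
  exists O; split; [exact HO|]. split; [exact HLO|].
  exists (eps / 2); split; [lra|].
  intros x y Lx Ox Ly Oy; apply family_dist_le; [lra|].
  intros n f Hf.
  pose proof (unit_diff_le f x y (F_unit _ _ Hf)).
  pose proof (pow_half_pos n); pose proof (pow_half_le 0 n (Nat.le_0_l n)).
  pose proof (Rabs_pos (f x - f y)); simpl in *.
  destruct (Nat.lt_ge_cases n N) as [Hn|Hn].
  - specialize (H n f x y Hn Hf Lx Ox Ly Oy); nra.
  - pose proof (pow_half_le N n Hn); nra.
Qed.

End FamilyMetric.

(** * Urysohn functions *)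

Definition step (t x : B) : R := if excluded_middle_informative (lt x t) then 0 else 1.

Lemma step_lt (t x : B) : lt x t -> step t x = 0.
Proof. unfold step; destruct excluded_middle_informative; tauto. Qed.

Lemma step_ge (t x : B) : ~ lt x t -> step t x = 1.
Proof. unfold step; destruct excluded_middle_informative; tauto. Qed.

Lemma step_unit (t : B) : unit_valued (step t).
Proof. intros x; unfold step; destruct excluded_middle_informative; lra. Qed.

Definition adjacent (p t : B) : Prop := lt p t /\ forall z, ~ (lt p z /\ lt z t).

(** Both pieces on which [step t] is constant are open rays: adjacency makes the points above [p]
    exactly those not below [t]. *)
Lemma step_continuous (p t : B) : adjacent p t -> order_continuous lt (step t).
Proof.
  intros [Hpt Hadj] x eps He.
  destruct (classic (lt x t)) as [Hx|Hx].
  - exists None, (Some t); split; [split; [exact I|exact Hx]|].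
    intros y [_ Hy]; simpl in Hy; rewrite !step_lt, Rminus_diag, Rabs_R0 by assumption; lra.
  - exists (Some p), None; split.
    + split; [|exact I]. exact (lt_le_trans _ _ _ Hpt (not_lt_le _ _ Hx)).
    + intros y [Hy _]; simpl in Hy; rewrite !step_ge, Rminus_diag, Rabs_R0; [lra|exact Hx|].
      intros H; apply (Hadj y); auto.
Qed.

Definition separates (s t : B) (f : B -> R) : Prop :=
  unit_valued f /\ order_continuous lt f /\
  (forall x, le_of lt x s -> f x = 0) /\ (forall x, le_of lt t x -> f x = 1).

Section Bisection.

Variable mid : B -> B -> B.

(** A staircase on the [2 ^ n] pieces obtained by iterated splitting at midpoints, with a jump of
    [(1 / 2) ^ n] at the right end of each piece. In the limit the jumps disappear. *)
Fixpoint bisect (n : nat) (a b x : B) : R :=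
  match n with
  | O => step b x
  | S n => if excluded_middle_informative (lt x (mid a b))
           then bisect n a (mid a b) x / 2
           else 1 / 2 + bisect n (mid a b) b x / 2
  end.

Lemma bisect_unit (n : nat) (a b : B) : unit_valued (bisect n a b).
Proof.
  revert a b; induction n as [|n IH]; intros a b x; [apply step_unit|]; simpl.
  destruct excluded_middle_informative.
  - pose proof (IH a (mid a b) x); lra.
  - pose proof (IH (mid a b) b x); lra.
Qed.

Variables s t : B.
Hypothesis mid_between : forall a b, le_of lt s a -> lt a b -> le_of lt b t ->
  lt a (mid a b) /\ lt (mid a b) b.

Definition inside (a b : B) : Prop := le_of lt s a /\ lt a b /\ le_of lt b t.

Lemma inside_mid (a b : B) : inside a b ->
  (lt a (mid a b) /\ lt (mid a b) b) /\ inside a (mid a b) /\ inside (mid a b) b.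
Proof.
  intros (Ha & Hab & Hb).
  destruct (mid_between a b Ha Hab Hb) as [H1 H2].
  split; [auto|]. split; (split; [|split]); auto.
  - left; eapply lt_le_trans; eauto.
  - left; eapply le_lt_trans; eauto.
Qed.

(** Splitting a piece moves half of its jump leftwards, from the right end to the midpoint, which
    can only raise the values. *)
Lemma bisect_growing (a b x : B) : inside a b -> Un_growing (fun n => bisect n a b x).
Proof.
  intros Hin n; revert a b Hin; induction n as [|n IH]; intros a b Hin;
    destruct (inside_mid a b Hin) as ((H1 & H2) & I1 & I2).
  - simpl; destruct excluded_middle_informative as [Hx|Hx].
    + rewrite (step_lt b x) by eauto. pose proof (step_unit (mid a b) x); lra.
    + pose proof (step_unit b x); lra.
  (* Only one level of the recursion is unfolded on each side, so that both sides branch on the same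
     test and the induction hypothesis applies in each half. *)
  - change (bisect (S (S n)) a b x) with
      (if excluded_middle_informative (lt x (mid a b))
       then bisect (S n) a (mid a b) x / 2 else 1 / 2 + bisect (S n) (mid a b) b x / 2).
    change (bisect (S n) a b x) with
      (if excluded_middle_informative (lt x (mid a b))
       then bisect n a (mid a b) x / 2 else 1 / 2 + bisect n (mid a b) b x / 2).
    destruct excluded_middle_informative.
    + specialize (IH _ _ I1); lra.
    + specialize (IH _ _ I2); lra.
Qed.

Lemma bisect_bound (a b x : B) : bound (EUn (fun n => bisect n a b x)).
Proof. exists 1; intros r [n ->]; apply bisect_unit. Qed.

(** As a supremum this makes sense for all [a] and [b]; monotonicity, available when [inside a b]
    holds, turns it into a limit. *)
Definition bisect_lim (a b x : B) : R :=
  proj1_sig (completeness _ (bisect_bound a b x) (EUn_noempty _)).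

Lemma bisect_lim_cv (a b x : B) :
  inside a b -> Un_cv (fun n => bisect n a b x) (bisect_lim a b x).
Proof.
  intros Hin; unfold bisect_lim; destruct completeness as [l Hl]; simpl.
  apply Un_cv_crit_lub; [apply bisect_growing; exact Hin|exact Hl].
Qed.

Lemma bisect_lim_unit (a b : B) : unit_valued (bisect_lim a b).
Proof.
  intros x; unfold bisect_lim; destruct completeness as [l Hlub]; simpl; destruct Hlub as [Hu Hl]; split.
  - apply Rle_trans with (bisect 0 a b x); [apply bisect_unit|].
    apply Hu; exists 0%nat; reflexivity.
  - apply Hl; intros r [n ->]; apply bisect_unit.
Qed.

Lemma Un_cv_const (c : R) : Un_cv (fun _ => c) c.
Proof. intros eps He; exists 0%nat; intros; rewrite Rdist_eq; exact He. Qed.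

(** The recursion defining [bisect] passes to the limit, since the sequence shifted by one index has
    the same limit. The same argument gives the equation for the right half. *)
Lemma bisect_lim_left (a b x : B) : inside a b -> lt x (mid a b) ->
  bisect_lim a b x = bisect_lim a (mid a b) x / 2.
Proof.
  intros Hin Hx; destruct (inside_mid a b Hin) as (_ & I1 & _).
  eapply UL_sequence; [exact (CV_shift' _ 1 _ (bisect_lim_cv a b x Hin))|].
  apply Un_cv_ext with (fun n => bisect n a (mid a b) x * / 2).
  - intros n; rewrite Nat.add_1_r; simpl; destruct excluded_middle_informative; tauto.
  - apply CV_mult; [apply bisect_lim_cv, I1|apply Un_cv_const].
Qed.

Lemma bisect_lim_right (a b x : B) : inside a b -> ~ lt x (mid a b) ->
  bisect_lim a b x = 1 / 2 + bisect_lim (mid a b) b x / 2.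
Proof.
  intros Hin Hx; destruct (inside_mid a b Hin) as (_ & _ & I2).
  eapply UL_sequence; [exact (CV_shift' _ 1 _ (bisect_lim_cv a b x Hin))|].
  apply Un_cv_ext with (fun n => 1 / 2 + bisect n (mid a b) b x * / 2).
  - intros n; rewrite Nat.add_1_r; simpl; destruct excluded_middle_informative; tauto.
  - apply CV_plus; [apply Un_cv_const|].
    apply CV_mult; [apply bisect_lim_cv, I2|apply Un_cv_const].
Qed.

(** Such an [x] falls into the left half at every stage, so all approximations vanish. The mirror
    image handles points from [b] on. *)
Lemma bisect_lim_le_left (a b x : B) : inside a b -> le_of lt x a -> bisect_lim a b x = 0.
Proof.
  intros Hin Hx.
  eapply UL_sequence; [apply bisect_lim_cv, Hin|].
  apply Un_cv_ext with (fun _ => 0); [|apply Un_cv_const].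
  intros n; revert b Hin; induction n as [|n IH]; intros b Hin.
  - simpl; rewrite step_lt; [reflexivity|].
    apply le_lt_trans with a; [exact Hx|apply Hin].
  - destruct (inside_mid a b Hin) as ((H1 & _) & I1 & _).
    simpl; destruct excluded_middle_informative as [H|H].
    + rewrite <- IH by assumption; lra.
    + destruct H; eapply le_lt_trans; eauto.
Qed.

Lemma bisect_lim_ge_right (a b x : B) : inside a b -> le_of lt b x -> bisect_lim a b x = 1.
Proof.
  intros Hin Hx.
  eapply UL_sequence; [apply bisect_lim_cv, Hin|].
  apply Un_cv_ext with (fun _ => 1); [|apply Un_cv_const].
  intros n; revert a Hin; induction n as [|n IH]; intros a Hin.
  - simpl; rewrite step_ge; [reflexivity|]. apply le_not_lt, Hx.
  - destruct (inside_mid a b Hin) as ((_ & H2) & _ & I2).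
    simpl; destruct excluded_middle_informative as [H|H].
    + destruct (le_not_lt _ _ Hx). eauto.
    + rewrite <- IH by assumption; lra.
Qed.

(* The oscillation halves at each use of the two functional equations; at the
   midpoint [c] itself the two halves agree because the left one is [1] and the right one is [0] there. *)
Lemma bisect_lim_osc (n : nat) (a b x : B) : inside a b ->
  exists lo hi, in_interval lt lo hi x /\ forall y, in_interval lt lo hi y ->
    Rabs (bisect_lim a b y - bisect_lim a b x) <= (1 / 2) ^ n.
Proof.
  revert a b; induction n as [|n IH]; intros a b Hin.
  - exists None, None; split; [repeat split|].
    intros y _; apply unit_diff_le, bisect_lim_unit.
  - destruct (inside_mid a b Hin) as ((H1 & H2) & I1 & I2).
    set (c := mid a b) in *; simpl.
    destruct (IH _ _ I1) as (l1 & h1 & J1 & C1), (IH _ _ I2) as (l2 & h2 & J2 & C2).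
    assert (Hhalf : forall u v : R, Rabs (u - v) <= (1 / 2) ^ n ->
      forall w, w = (u - v) / 2 -> Rabs w <= 1 / 2 * (1 / 2) ^ n).
    { intros u v Huv w ->; unfold Rdiv at 1; rewrite Rabs_mult, (Rabs_pos_eq (/ 2)); lra. }
    destruct (tot x c) as [Hx|[Hx|Hx]].
    + destruct (in_interval_inter l1 h1 None (Some c) x J1) as (l & h & J & K);
        [split; [exact I|exact Hx]|].
      exists l, h; split; [exact J|]; intros y Hy; destruct (K y Hy) as [Ky [_ Hyc]].
      eapply Hhalf; [apply (C1 y Ky)|].
      rewrite !(bisect_lim_left a b) by assumption; fold c; lra.
    + destruct (in_interval_inter _ _ _ _ _ J1 J2) as (l & h & J & K).
      exists l, h; split; [exact J|]; intros y Hy; destruct (K y Hy) as [K1 K2].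
      assert (Hxc : ~ lt x c) by (rewrite Hx; apply irr).
      destruct (classic (lt y c)) as [Hyc|Hyc].
      * eapply Hhalf; [apply (C1 y K1)|].
        rewrite (bisect_lim_left a b y), (bisect_lim_right a b x) by assumption; fold c.
        rewrite (bisect_lim_le_left c b x), (bisect_lim_ge_right a c x);
          try assumption; try lra; right; congruence.
      * eapply Hhalf; [apply (C2 y K2)|].
        rewrite !(bisect_lim_right a b) by assumption; fold c; lra.
    + destruct (in_interval_inter l2 h2 (Some c) None x J2) as (l & h & J & K);
        [split; [exact Hx|exact I]|].
      exists l, h; split; [exact J|]; intros y Hy; destruct (K y Hy) as [Ky [Hyc _]].
      eapply Hhalf; [apply (C2 y Ky)|].
      rewrite !(bisect_lim_right a b) by (first [assumption | intros H; apply (irr c); eauto]).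
      fold c; lra.
Qed.

Lemma bisect_lim_separates : lt s t -> separates s t (bisect_lim s t).
Proof.
  intros Hst.
  assert (Hin : inside s t) by (split; [right|split; [|right]]; auto).
  split; [apply bisect_lim_unit|]. split; [|split].
  - intros x eps He; destruct (pow_half_small eps He) as [n Hn].
    destruct (bisect_lim_osc n s t x Hin) as (lo & hi & J & C).
    exists lo, hi; split; [exact J|]; intros y Hy; specialize (C y Hy); lra.
  - intros x Hx; apply bisect_lim_le_left; assumption.
  - intros x Hx; apply bisect_lim_ge_right; assumption.
Qed.

End Bisection.

(** If the interval from [s] to [t] contains an adjacent pair, a step at that jump separates.
    Otherwise it is densely ordered, midpoints can be chosen, and the bisection limit separates. *)
Lemma urysohn (s t : B) : lt s t -> exists f, separates s t f.
Proof.
  intros Hst.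
  destruct (classic (exists a b, le_of lt s a /\ le_of lt b t /\ adjacent a b))
    as [(a & b & Ha & Hb & Hab)|Hdense].
  - exists (step b); split; [apply step_unit|]. split; [exact (step_continuous a b Hab)|].
    split; intros x Hx.
    + apply step_lt. eapply le_lt_trans; [exact Hx|]. eapply le_lt_trans; [exact Ha|apply Hab].
    + apply step_ge; intros Hxb. eapply le_not_lt; [exact Hx|]. eapply lt_le_trans; eauto.
  (* Where nothing lies between [a] and [b] the value of [mid] is arbitrary; [inhabits s] only
     witnesses that [B] is nonempty. *)
  - set (mid := fun a b => epsilon (inhabits s) (fun z => lt a z /\ lt z b)).
    exists (bisect_lim mid s t); apply bisect_lim_separates; [|exact Hst].
    intros a b Ha Hab Hb.
    apply (epsilon_spec (inhabits s) (fun z => lt a z /\ lt z b)).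
    apply NNPP; intros Hn; apply Hdense.
    exists a, b; repeat split; auto; intros z Hz; apply Hn; eauto.
Qed.

(** One function is fixed for each pair, so that a single gap contributes a single function to the
    family. The constant [0] only witnesses that the function type is nonempty. *)
Definition urysohn_fun (s t : B) : B -> R := epsilon (inhabits (fun _ => 0)) (separates s t).

Lemma urysohn_fun_separates (s t : B) : lt s t -> separates s t (urysohn_fun s t).
Proof. intros Hst; exact (epsilon_spec _ (separates s t) (urysohn s t Hst)). Qed.

(** * Increasing sequences of well ordered sets *)

Section WellOrderedUnion.

Variable T : nat -> B -> Prop.
Hypothesis T_incr : forall n x, T n x -> T (S n) x.
Hypothesis T_wo : forall n, well_ordered_set lt (T n).
Hypothesis T_dense : forall x y, lt x y -> exists n t, T n t /\ lt x t /\ le_of lt t y.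

Lemma T_mono (n k : nat) (x : B) : (n <= k)%nat -> T n x -> T k x.
Proof. induction 1; auto. Qed.

Definition consecutive (n : nat) (s t : B) : Prop :=
  T n s /\ T n t /\ lt s t /\ forall u, T n u -> ~ (lt s u /\ lt u t).

(** The predecessor [p] is taken in all of [B], as continuity of [step t] requires, whereas
    [consecutive] refers to gaps of [T n], which may contain further points of [B]. *)
Definition level_family (n : nat) (f : B -> R) : Prop :=
  (exists p t, T n t /\ adjacent p t /\ f = step t) \/
  (exists s t, consecutive n s t /\ f = urysohn_fun s t).

Lemma level_family_unit (n : nat) (f : B -> R) : level_family n f -> unit_valued f.
Proof.
  intros [(p & t & _ & _ & ->)|(s & t & (_ & _ & Hst & _) & ->)].
  - apply step_unit.
  - apply urysohn_fun_separates, Hst.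
Qed.

Lemma level_family_continuous (n : nat) (f : B -> R) :
  level_family n f -> order_continuous lt f.
Proof.
  intros [(p & t & _ & Hpt & ->)|(s & t & (_ & _ & Hst & _) & ->)].
  - exact (step_continuous p t Hpt).
  - apply urysohn_fun_separates, Hst.
Qed.

(** Well-ordering gives [p] an immediate successor [q] in [T n], and [q] is at most [t]. The Urysohn
    function of [p] and [q] is then [0] at [x] and [1] at [y]. *)
Lemma level_family_sep_of_two (n : nat) (x y p t : B) :
  T n p -> T n t -> le_of lt x p -> lt p t -> le_of lt t y ->
  exists f, level_family n f /\ f x <> f y.
Proof.
  intros Tp Tt Hxp Hpt Hty.
  destruct (T_wo n (fun u => T n u /\ lt p u)) as (q & [Tq Hpq] & Hq);
    [tauto|eauto|].
  assert (Hc : consecutive n p q).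
  { repeat split; auto. intros u Tu [H1 H2]. eapply le_not_lt; [apply Hq|]; eauto. }
  exists (urysohn_fun p q); split; [right; eauto|].
  destruct (urysohn_fun_separates p q Hpq) as (_ & _ & H0 & H1).
  rewrite H0, H1; [lra| |exact Hxp].
  destruct (Hq t (conj Tt Hpt)) as [Hqt| ->]; [|exact Hty].
  left; eapply lt_le_trans; eauto.
Qed.

(** Density gives [t] in some level, above [x] and at most [y]. If [x] is the immediate predecessor
    of [t], then [step t] separates; otherwise density gives another element [p] between [x] and
    [t], and both lie in a common level. *)
Lemma level_family_separates (x y : B) :
  lt x y -> exists n f, level_family n f /\ f x <> f y.
Proof.
  intros Hxy; destruct (T_dense x y Hxy) as (n & t & Tt & Hxt & Hty).
  destruct (classic (exists z, lt x z /\ lt z t)) as [[z [Hxz Hzt]]|Hadj].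
  - destruct (T_dense x z Hxz) as (k & p & Tp & Hxp & Hpz).
    exists (max n k); apply (level_family_sep_of_two _ x y p t).
    + apply (T_mono k); [lia|exact Tp].
    + apply (T_mono n); [lia|exact Tt].
    + left; exact Hxp.
    + eapply le_lt_trans; eauto.
    + exact Hty.
  - exists n, (step t); split.
    + left; exists x, t; repeat split; auto. intros z Hz; apply Hadj; eauto.
    + rewrite step_lt, step_ge; [lra| |exact Hxt]. apply le_not_lt, Hty.
Qed.

(** Let [t0] be the least element of [T n] above some point of [L], and take the ray below [t0]. Any
    element of [T n] above a point of [L] is at least [t0], hence above the whole ray. Without such
    a [t0] the condition is vacuous. *)
Lemma exists_open_same_cut (n : nat) (L : B -> Prop) : (exists x, L x) ->
  exists O, order_open lt O /\ (exists x, L x /\ O x) /\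
    forall x y t, L x -> O x -> L y -> O y -> T n t -> lt x t -> lt y t.
Proof.
  intros [x0 Lx0].
  destruct (classic (exists t, T n t /\ exists x, L x /\ lt x t)) as [Hex|Hno].
  - destruct (T_wo n (fun t => T n t /\ exists x, L x /\ lt x t))
      as (t0 & (Tt0 & x & Lx & Hx) & Hmin); [tauto|exact Hex|].
    exists (fun y => lt y t0); split; [|split].
    + intros y Hy; exists None, (Some t0); split; [split; [exact I|exact Hy]|].
      intros z [_ Hz]; exact Hz.
    + eauto.
    + intros u v t Lu _ Lv Hv Tt Hut. eapply lt_le_trans; [exact Hv|]. apply Hmin; eauto.
  - exists (fun _ => True); split; [|split].
    + intros y _; exists None, None; repeat split.
    + eauto.
    + intros u v t Lu _ _ _ Tt Hut; destruct Hno; eauto.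
Qed.

(** If two gaps contained [x] but differed, an endpoint of one would be an element of [T n] strictly
    inside the other. *)
Lemma consecutive_unique (n : nat) (s t s' t' x : B) :
  consecutive n s t -> consecutive n s' t' ->
  ~ lt x s -> lt x t -> ~ lt x s' -> lt x t' -> s = s' /\ t = t'.
Proof.
  intros (Ts & Tt & Hst & Hc) (Ts' & Tt' & Hst' & Hc') H1 H2 H1' H2'.
  apply not_lt_le in H1; apply not_lt_le in H1'.
  assert (s = s') as <-.
  { destruct (tot s s') as [H|[H|H]]; [|exact H|].
    - destruct (Hc s' Ts'); split; [exact H|]. eapply le_lt_trans; eauto.
    - destruct (Hc' s Ts); split; [exact H|]. eapply le_lt_trans; eauto. }
  split; [reflexivity|].
  destruct (tot t t') as [H|[H|H]]; [|exact H|].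
  - destruct (Hc' t Tt); auto.
  - destruct (Hc t' Tt'); auto.
Qed.

Lemma level_family_frag (n : nat) (L : B -> Prop) (eps : R) :
  (exists x, L x) -> 0 < eps ->
  exists O, order_open lt O /\ (exists x, L x /\ O x) /\
    forall f x y, level_family n f -> L x -> O x -> L y -> O y -> Rabs (f x - f y) <= eps.
Proof.
  intros HL He.
  destruct (exists_open_same_cut n L HL) as (O & HO & (x0 & Lx0 & Ox0) & Hcut).
  (* All points of [L] in [O] lie below the same elements of [T n]. So steps are constant there, and
     a Urysohn function is constantly [0] or [1] unless its gap contains [x0]. *)
  assert (Hvary : forall f x y, level_family n f -> L x -> O x -> L y -> O y ->
    f x = f y \/ exists s t, consecutive n s t /\ ~ lt x0 s /\ lt x0 t /\ f = urysohn_fun s t).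
  { intros f x y [(p & t & Tt & _ & ->)|(s & t & Hc & ->)] Lx Ox Ly Oy.
    - left; destruct (classic (lt x t)) as [H|H].
      + rewrite !step_lt; eauto.
      + rewrite !step_ge; eauto.
    - destruct Hc as (Ts & Tt & Hst & Hc).
      destruct (urysohn_fun_separates s t Hst) as (_ & _ & H0 & H1).
      destruct (classic (lt x0 s)) as [Hs|Hs].
      { left; rewrite !H0; [reflexivity| |]; left; apply (Hcut x0); auto. }
      destruct (classic (lt x0 t)) as [Ht|Ht].
      { right; exists s, t; repeat split; auto. }
      left; rewrite !H1; [reflexivity| |]; apply not_lt_le; eauto. }
  destruct (classic (exists s t, consecutive n s t /\ ~ lt x0 s /\ lt x0 t))
    as [(s & t & Hc & Hs & Ht)|Hno].
  - assert (Hst : lt s t) by apply Hc.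
    destruct (urysohn_fun_separates s t Hst) as (_ & Hcont & _).
    (* Two points are compared through [x0], so each may deviate by [eps / 2]. By uniqueness of the
       gap around [x0], this one neighbourhood serves the whole family. *)
    destruct (Hcont x0 (eps / 2) ltac:(lra)) as (lo & hi & J & C).
    exists (fun x => O x /\ in_interval lt lo hi x); split; [|split].
    + apply order_open_inter; [exact HO|apply order_open_interval].
    + eauto.
    + intros f x y Hf Lx [Ox Jx] Ly [Oy Jy].
      destruct (Hvary f x y Hf Lx Ox Ly Oy) as [->|(s' & t' & Hc' & Hs' & Ht' & ->)].
      * rewrite Rminus_diag, Rabs_R0; lra.
      * destruct (consecutive_unique n s t s' t' x0) as [<- <-]; auto.
        pose proof (C x Jx) as Cx; pose proof (C y Jy) as Cy.
        set (g := urysohn_fun s t) in *.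
        replace (g x - g y) with ((g x - g x0) + - (g y - g x0)) by ring.
        eapply Rle_trans; [apply Rabs_triang|rewrite Rabs_Ropp; lra].
  - exists O; split; [exact HO|]. split; [eauto|].
    intros f x y Hf Lx Ox Ly Oy.
    destruct (Hvary f x y Hf Lx Ox Ly Oy) as [->|(s & t & Hc & Hs & Ht & _)].
    + rewrite Rminus_diag, Rabs_R0; lra.
    + destruct Hno; eauto.
Qed.

Lemma exists_lsc_fragmenting_metric :
  exists d, is_metric d /\ lower_semicontinuous lt d /\ fragments lt d.
Proof.
  exists (family_dist level_family level_family_unit); split; [|split].
  - apply family_dist_metric, level_family_separates.
  - apply family_dist_lsc, level_family_continuous.
  - apply family_dist_fragments, level_family_frag.
Qed.

End WellOrderedUnion.

End LinearOrder.

(** * Transfer to the completion *)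

Lemma well_ordered_set_image (A B : Type) (ltA : A -> A -> Prop) (ltB : B -> B -> Prop)
  (S : A -> Prop) (e : A -> B) :
  (forall a b, S a -> S b -> ltA a b -> ltB (e a) (e b)) ->
  well_ordered_set ltA S -> well_ordered_set ltB (fun b => exists a, S a /\ e a = b).
Proof.
  intros He Hwo P HP [b Pb].
  destruct (Hwo (fun a => S a /\ P (e a))) as (a & [Sa Pa] & Hmin).
  - tauto.
  - destruct (HP b Pb) as (a & Sa & <-); eauto.
  - exists (e a); split; [exact Pa|].
    intros x Px; destruct (HP x Px) as (a' & Sa' & <-).
    destruct (Hmin a' (conj Sa' Px)) as [H|<-]; [left; auto|right; reflexivity].
Qed.

Theorem theorem6 (A : Type) (ltA : A -> A -> Prop) (Tn : nat -> A -> Prop)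
  (HA : StrictLinOrder A ltA)
  (Hincr : forall n a, Tn n a -> Tn (S n) a)
  (Hwo : forall n, well_ordered_set ltA (Tn n))
  (m M : A)
  (Hmin : forall n, is_min_of ltA (Tn n) m)
  (Hmax : forall n, is_max_of ltA (Tn n) M)
  (B : Type) (ltB : B -> B -> Prop) (e : A -> B)
  (Hcompl : is_completion ltA (fun a => exists n, Tn n a) ltB e) :
  RN_compact ltB.
Proof.
  destruct Hcompl as (HB & He & Hcomp & Hdense).
  split; [exact Hcomp|].
  (* The levels are replaced by their images under [e], which are well ordered subsets of [B]; the
     density clause of the completion supplies [T_dense]. *)
  apply (exists_lsc_fragmenting_metric B ltB HB (fun n b => exists a, Tn n a /\ e a = b)).
  - intros n b (a & Ha & <-); eauto.
  - intros n; apply well_ordered_set_image with ltA; [|apply Hwo].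
    intros a b Ha Hb; apply He; eauto.
  - intros x y Hxy; destruct (Hdense x y Hxy) as (a & [n Ha] & H1 & H2).
    exists n, (e a); eauto.
Qed.
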